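(* Let $n\ge 2$ and $G = SD_{8n} = \langle x, y : x^{4n} = y^2 = 1,\ yxy = x^{2n -1}\rangle$. (1) If $n= 2, 3$ then $\mathcal{CCC}(G)$ is neither hyperenergetic, borderenergetic, L-hyperenergetic, L-borderenergetic, Q-hyperenergetic nor Q-borderenergetic. (2) If $n=5$ then $\mathcal{CCC}(G)$ is L-hyperenergetic and Q-borderenergetic but neither hyperenergetic, borderenergetic, L-borderenergetic nor Q-hyperenergetic. (3) If $n = 4$ or $n\geq 6$ then $\mathcal{CCC}(G)$ is L-hyperenergetic and Q-hyperenergetic but neither hyperenergetic, borderenergetic, L-borderenergetic nor Q-borderenergetic.
   Context: For a finite non-abelian group $G$, the commuting conjugacy class graph $\mathcal{CCC}(G)$ is the simple undirected graph whose vertices are the conjugacy classes of the non-central elements of $G$; two distinct vertices $x^G$ and $y^G$ are adjacent iff there exist $x'\in x^G$ and $y'\in y^G$ with $x'y'=y'x'$. For a finite graph $\mathcal{G}$ with adjacency matrix $A(\mathcal{G})$ and (diagonal) degree matrix $D(\mathcal{G})$, put $L(\mathcal{G})=D(\mathcal{G})-A(\mathcal{G})$ and $Q(\mathcal{G})=D(\mathcal{G})+A(\mathcal{G})$, and let $\mathrm{Spec}(\mathcal{G})$, $\mathrm{L\text{-}Spec}(\mathcal{G})$, $\mathrm{Q\text{-}Spec}(\mathcal{G})$ be the multisets of eigenvalues of $A(\mathcal{G})$, $L(\mathcal{G})$, $Q(\mathcal{G})$. With $d=\frac{2|e(\mathcal{G})|}{|V(\mathcal{G})|}$ (twice the number of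 edges over the number of vertices), put $E(\mathcal{G})=\sum_{\lambda\in \mathrm{Spec}(\mathcal{G})}|\lambda|$, $LE(\mathcal{G})=\sum_{\mu\in \mathrm{L\text{-}Spec}(\mathcal{G})}|\mu-d|$, $LE^+(\mathcal{G})=\sum_{\nu\in \mathrm{Q\text{-}Spec}(\mathcal{G})}|\nu-d|$ (sums with multiplicity). Let $\mathcal{G}$ have $N$ vertices and let $K_N$ be the complete graph on $N$ vertices (for which $E(K_N)=LE(K_N)=LE^+(K_N)=2(N-1)$). $\mathcal{G}$ is hyperenergetic, L-hyperenergetic or Q-hyperenergetic according as $E(K_N)<E(\mathcal{G})$, $LE(K_N)<LE(\mathcal{G})$ or $LE^+(K_N)<LE^+(\mathcal{G})$; it is borderenergetic, L-borderenergetic or Q-borderenergetic according as $E(K_N)=E(\mathcal{G})$, $LE(K_N)=LE(\mathcal{G})$ or $LE^+(K_N)=LE^+(\mathcal{G})$. *)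

(* Defs.v *)
From HB Require Import structures.
From mathcomp Require Import all_boot all_order all_algebra all_fingroup.
From mathcomp Require Import all_solvable all_field.

Set Implicit Arguments.
Unset Strict Implicit.
Unset Printing Implicit Defensive.

Import Order.TTheory GRing.Theory Num.Theory.

Record sgraph := SGraph {
  svertex :> finType;
  sedge : rel svertex;
  sedge_sym : symmetric sedge;
  sedge_irrefl : irreflexive sedge
}.

Definition edges (X : sgraph) : {set {set X}} :=
  [set e : {set X} |
    [exists u : X, [exists v : X, sedge u v && (e == [set u; v])]]].

Definition degree (X : sgraph) (u : X) : nat := #|[set v : X | sedge u v]|.

Lemma complete_sym (N : nat) : symmetric (fun u v : 'I_N => u != v).
Proof. by move=> u v; rewrite eq_sym. Qed.

Lemma complete_irrefl (N : nat) : irreflexive (fun u v : 'I_N => u != v).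
Proof. by move=> u; rewrite eqxx. Qed.

Definition complete_graph (N : nat) : sgraph :=
  SGraph (@complete_sym N) (@complete_irrefl N).

Section Spectra.
Local Open Scope ring_scope.

(* Multisets of eigenvalues are represented by sequences, the order of which
   is irrelevant. The matrices below have integer entries, so all their
   eigenvalues lie in algC, and the roots of the characteristic polynomial
   are the eigenvalues with algebraic multiplicity. *)
Definition eigenvalues (n : nat) (M : 'M[algC]_n) : seq algC :=
  sval (closed_field_poly_normal (char_poly M)).

Lemma char_poly_eigenvalues (n : nat) (M : 'M[algC]_n) :
  char_poly M = \prod_(z <- eigenvalues M) ('X - z%:P).
Proof.
rewrite /eigenvalues; case: closed_field_poly_normal => r /= {1}->.
by rewrite (monicP (char_poly_monic M)) scale1r.
Qed.

Definition adjacency_mx (X : sgraph) : 'M[algC]_#|X| :=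
  \matrix_(i, j) (sedge (enum_val i) (enum_val j))%:R.

Definition degree_mx (X : sgraph) : 'M[algC]_#|X| :=
  diag_mx (\row_i (degree (enum_val i))%:R).

Definition laplacian_mx (X : sgraph) : 'M[algC]_#|X| :=
  degree_mx X - adjacency_mx X.

Definition signless_laplacian_mx (X : sgraph) : 'M[algC]_#|X| :=
  degree_mx X + adjacency_mx X.

Definition average_degree (X : sgraph) : algC :=
  (2 * #|edges X|)%N%:R / #|X|%:R.

Definition energy (X : sgraph) : algC :=
  \sum_(l <- eigenvalues (adjacency_mx X)) `|l|.

Definition laplacian_energy (X : sgraph) : algC :=
  \sum_(m <- eigenvalues (laplacian_mx X)) `|m - average_degree X|.

Definition signless_laplacian_energy (X : sgraph) : algC :=
  \sum_(v <- eigenvalues (signless_laplacian_mx X)) `|v - average_degree X|.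

(* The order of algC is partial, but energies are sums of moduli, hence real,
   so the comparisons below are comparisons of real numbers. *)
Definition hyperenergetic (X : sgraph) : bool :=
  energy (complete_graph #|X|) < energy X.

Definition L_hyperenergetic (X : sgraph) : bool :=
  laplacian_energy (complete_graph #|X|) < laplacian_energy X.

Definition Q_hyperenergetic (X : sgraph) : bool :=
  signless_laplacian_energy (complete_graph #|X|)
    < signless_laplacian_energy X.

Definition borderenergetic (X : sgraph) : bool :=
  energy (complete_graph #|X|) == energy X.

Definition L_borderenergetic (X : sgraph) : bool :=
  laplacian_energy (complete_graph #|X|) == laplacian_energy X.

Definition Q_borderenergetic (X : sgraph) : bool :=
  signless_laplacian_energy (complete_graph #|X|)
    == signless_laplacian_energy X.

End Spectra.

Section CommutingConjugacyClassGraph.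
Local Open Scope group_scope.
Variables (gT : finGroupType) (G : {group gT}).

Definition noncentral_classes : {set {set gT}} :=
  [set x ^: G | x in G :\: 'Z(G)].

Definition ccc_vertex : finType := {C : {set gT} | C \in noncentral_classes}.

Definition ccc_edge : rel ccc_vertex := fun C D =>
  (C != D) &&
  [exists x in val C, [exists y in val D, x * y == y * x]].

Lemma ccc_sym : symmetric ccc_edge.
Proof.
move=> C D; rewrite /ccc_edge eq_sym; congr (_ && _).
by apply/exists_inP/exists_inP => -[x Cx /exists_inP[y Dy xy]];
   exists y => //; apply/exists_inP; exists x; rewrite // eq_sym.
Qed.

Lemma ccc_irrefl : irreflexive ccc_edge.
Proof. by move=> C; rewrite /ccc_edge eqxx. Qed.

Definition CCC : sgraph := SGraph ccc_sym ccc_irrefl.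

End CommutingConjugacyClassGraph.

(* Main.v *)
Require Import Defs.
From mathcomp Require Import all_boot all_order all_algebra all_fingroup.
From mathcomp Require Import all_solvable all_field.
From mathcomp Require Import ring lra zify.

Set Implicit Arguments.
Unset Strict Implicit.
Unset Printing Implicit Defensive.

Import Order.TTheory GRing.Theory Num.Theory.

(* The cyclic subgroup <x> is abelian of index 2 in G.  For any nonabelian G
   with such a subgroup N and centre Z, the noncentral classes inside N have
   two elements each and form a clique of (|N| - |Z|) / 2 vertices that is a
   union of components, and there are |Z| classes outside N.  In SD_8n two of
   the latter commute only if they are equal when n is even, and always when n
   is odd, so the graph is K_(2n-1) + 2 K_1 for n even (|Z| = 2) and
   K_(2n-2) + K_4 for n odd (|Z| = 4).  The three spectra of a disjoint union
   of cliques are explicit, and rational inequalities remain. *)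

(** * Spectra of disjoint unions of cliques *)

Section CliqueSpectra.
Local Open Scope ring_scope.

(* With U the incidence matrix of the blocks, D = diag(X - a_(f i)) and
   D' = diag(X - a_c), one has XI - M = D - b U U^T and U^T D = D' U^T.
   Computing the determinant of [[D, U], [b U^T, 1]] by eliminating either
   block column gives the identity, without inverting D. *)
Lemma char_poly_blocks (R : comNzRingType) (n : nat) (B : finType)
    (f : 'I_n -> B) (a : B -> R) (b : R) (M : 'M[R]_n) :
    (forall i j, M i j = a (f i) *+ (i == j) + b *+ (f i == f j)) ->
  char_poly M * \prod_c ('X - (a c)%:P) =
  \prod_i ('X - (a (f i))%:P)
    * \prod_c ('X - (a c + b *+ #|[set i | f i == c]|)%:P).
Proof.
move=> defM.
pose U : 'M[{poly R}]_(n, #|B|) := \matrix_(i, k) (f i == enum_val k)%:R.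
pose D := diag_mx (\row_i ('X - (a (f i))%:P)).
pose D' := diag_mx (\row_(k < #|B|) ('X - (a (enum_val k))%:P)).
pose V := b%:P *: U^T.
have UV : U *m V = \matrix_(i, j) (b *+ (f i == f j))%:P.
  apply/matrixP => i j; rewrite !mxE (bigD1 (enum_rank (f i))) //= big1.
    rewrite !mxE enum_rankK eqxx mul1r addr0 eq_sym.
    by case: eqP; rewrite ?mulr1 ?mulr0 ?mulr0n ?polyC0.
  move=> k /eqP nk; rewrite !mxE; case: eqP => [fk|]; last by rewrite mul0r.
  by case: nk; rewrite fk enum_valK.
have VU : V *m U =
    diag_mx (\row_k (b *+ #|[set i | f i == enum_val k]|)%:P).
  apply/matrixP => k l; rewrite !mxE.
  have [<-|nkl] := eqVneq k l.
    rewrite mulr1n -sumr_const raddf_sum /= [RHS]big_mkcond /=.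
    apply: eq_bigr => i _; rewrite !mxE inE.
    by case: eqP; rewrite ?mulr1 ?mulr0 ?mul0r.
  rewrite mulr0n big1 // => i _; rewrite !mxE; case: eqP => [->|]; last first.
    by rewrite mulr0 mul0r.
  case: eqP => [/enum_val_inj kl|]; last by rewrite mulr0.
  by rewrite kl eqxx in nkl.
have DV : D' *m V = V *m D.
  rewrite mul_diag_mx mul_mx_diag; apply/matrixP => k i; rewrite !mxE.
  by case: eqP => [->|]; rewrite ?mulr0 ?mul0r // mulrC.
have chiM : char_poly M = \det (block_mx D U V 1%:M).
  have: \det (block_mx 1%:M (- U) 0 1%:M *m block_mx D U V 1%:M)
        = \det (block_mx D U V 1%:M).
    by rewrite det_mulmx det_ublock !det1 !mul1r.
  move=> <-; rewrite mulmx_block !mul1mx !mul0mx !mulmx1 addrN !add0r.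
  rewrite det_lblock det1 mulr1 /char_poly mulNmx UV; congr (\det _).
  apply/matrixP => i j; rewrite !mxE defM polyCD opprD addrA polyCMn.
  by rewrite mulrnBl.
have detD' : \det D' = \prod_c ('X - (a c)%:P).
  rewrite det_diag [RHS](reindex (@enum_val _ B)) /=; last first.
    by apply: onW_bij; exact: enum_val_bij.
  by apply: eq_bigr => i _; rewrite !mxE.
have detD : \det D = \prod_i ('X - (a (f i))%:P).
  by rewrite det_diag; apply: eq_bigr => i _; rewrite !mxE.
rewrite chiM -detD' -detD mulrC.
have: \det (block_mx 1%:M 0 (- V) D' *m block_mx D U V 1%:M)
      = \det D' * \det (block_mx D U V 1%:M).
  by rewrite det_mulmx det_lblock det1 mul1r.
move=> <-; rewrite mulmx_block !mul1mx !mul0mx !mulmx1 !addr0.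
rewrite !mulNmx DV addNr det_ublock VU addrC; congr (_ * _).
rewrite -raddfB det_diag [RHS](reindex (@enum_val _ B)) /=; last first.
  by apply: onW_bij; exact: enum_val_bij.
by apply: eq_bigr => k _; rewrite !mxE polyCD opprD addrA.
Qed.

(** Both sides of [char_poly_blocks] split into linear factors, so their root multisets agree and
    the roots [a c] can be moved to the right. Subtracting [g (a c)] instead of using multiplicity
    [s - 1] makes an empty block contribute 0. *)
Lemma sum_eigenvalues_blocks (V : zmodType) (n : nat) (B : finType)
    (f : 'I_n -> B) (a : B -> algC) (b : algC) (M : 'M_n) (g : algC -> V) :
    (forall i j, M i j = a (f i) *+ (i == j) + b *+ (f i == f j)) ->
  \sum_(l <- eigenvalues M) g l =
  \sum_c (g (a c + b *+ #|[set i | f i == c]|)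
          + (g (a c) *+ #|[set i | f i == c]| - g (a c))).
Proof.
move=> defM; have := char_poly_blocks defM; rewrite char_poly_eigenvalues.
pose s c := #|[set i | f i == c]|; move=> chi.
have pe : perm_eq (eigenvalues M ++ [seq a c | c : B])
    ([seq a (f i) | i : 'I_n] ++ [seq a c + b *+ s c | c : B]).
  apply: prod_XsubC_eq; rewrite !big_cat !big_image /=.
  by rewrite chi; congr (_ * _); apply: eq_bigl.
have := perm_big (op := +%R) (x := 0) (P := predT) (F := g) _ pe.
rewrite !big_cat !big_image /=.
have -> : \sum_(i < n) g (a (f i)) = \sum_c g (a c) *+ s c.
  rewrite (partition_big f xpredT) //=; apply: eq_bigr => c _.
  rewrite -sumr_const; apply: eq_big => [i|i /eqP-> //]; by rewrite inE.
move=> /(canRL (addrK _)) ->; rewrite -sumrN -!big_split /=.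
by apply: eq_bigr => c _; rewrite -addrA addrCA.
Qed.

(** Double counting of ordered adjacent pairs: by first vertex, then by underlying edge, whose fibre
    is [(u, v)] and [(v, u)]. *)
Lemma sum_degree (X : sgraph) : (\sum_(u : X) degree u = 2 * #|edges X|)%N.
Proof.
transitivity (\sum_(p : X * X | sedge p.1 p.2) 1)%N.
  rewrite -(pair_big_dep xpredT (fun u v => sedge u v) (fun _ _ => 1%N)) /=.
  by apply: eq_bigr => u _; rewrite /degree -sum1_card; apply: eq_bigl => v;
    rewrite inE.
rewrite (partition_big (fun p : X * X => [set p.1; p.2]) (mem (edges X))) /=.
  rewrite mulnC -sum_nat_const; apply: eq_bigr => e.
  rewrite inE => /existsP[u /existsP[v /andP[uv /eqP->]]].
  have nuv : u != v by apply: contraTneq uv => ->; rewrite sedge_irrefl.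
  transitivity #|[set (u, v); (v, u)]|; last first.
    by rewrite cards2 xpair_eqE negb_and nuv.
  rewrite sum1_card; apply: eq_card => -[a b]; rewrite !inE unfold_in /=.
  rewrite !xpair_eqE; apply/andP/orP => [[ab /eqP eab]|]; last first.
    by case=> /andP[/eqP-> /eqP->]; rewrite ?uv // sedge_sym uv setUC.
  have nab : a != b by apply: contraTneq ab => ->; rewrite sedge_irrefl.
  have : a \in [set u; v] by rewrite -eab !inE eqxx.
  have : b \in [set u; v] by rewrite -eab !inE eqxx orbT.
  rewrite !inE => /orP[]/eqP eb /orP[]/eqP ea;
    by move: nab; rewrite ea eb ?eqxx //= => _; auto.
move=> -[u v] /= uv; rewrite inE; apply/existsP; exists u; apply/existsP.
by exists v; rewrite uv eqxx.
Qed.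

Definition block_size (X B : finType) (f : X -> B) (c : B) : nat :=
  #|[set u | f u == c]|.

(** The average degree of a union of cliques, kept in [rat] so that the comparisons to come take
    place in a totally ordered field. *)
Definition block_degree (X B : finType) (f : X -> B) : rat :=
  (\sum_c (block_size f c)%:R * ((block_size f c)%:R - 1))
    / \sum_c (block_size f c)%:R.

(** * Energies when the components are the fibres of a labelling [f] *)

Section CliqueUnion.
Variables (X : sgraph) (B : finType) (f : X -> B).
Hypothesis edgeE : forall u v : X, sedge u v = (u != v) && (f u == f v).

Lemma clique_degree u : (degree u).+1 = block_size f (f u).
Proof.
rewrite /block_size (cardsD1 u) inE eqxx add1n; congr _.+1.
by apply: eq_card => v; rewrite !inE edgeE eq_sym [f v == _]eq_sym.
Qed.

Lemma card_block_size : #|X| = (\sum_c block_size f c)%N.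
Proof.
rewrite -sum1_card (partition_big f xpredT) //=; apply: eq_bigr => c _.
by rewrite sum1_card /block_size cardsE.
Qed.

Lemma card_enum_block c :
  #|[set i : 'I_#|X| | f (enum_val i) == c]| = block_size f c.
Proof.
rewrite /block_size -(on_card_preimset (f := @enum_val X predT)).
  by apply: eq_card => i; rewrite !inE.
by apply: onW_bij; exact: enum_val_bij.
Qed.

Lemma clique_average_degree : average_degree X = ratr (block_degree f).
Proof.
rewrite /average_degree /block_degree -sum_degree.
rewrite fmorph_div /= card_block_size !natr_sum !rmorph_sum /=.
congr (_ / _); last by apply: eq_bigr => c _; rewrite ratr_nat.
rewrite (partition_big f xpredT) //=; apply: eq_bigr => c _.
rewrite rmorphM rmorphB /= rmorph1 ratr_nat.
rewrite (eq_bigr (fun=> (block_size f c)%:R - 1)) => [|u /eqP <-]; last first.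
  by rewrite -clique_degree -natr1 addrK.
by rewrite sumr_const mulr_natl /block_size cardsE.
Qed.

(** On a block of size s the matrix is J - I, with J all ones: eigenvalue s - 1 once and -1 with
    multiplicity s - 1. *)
Lemma clique_energy :
  energy X = ratr (\sum_c (`|(block_size f c)%:R - 1|
                            + ((block_size f c)%:R - 1))).
Proof.
rewrite /energy (sum_eigenvalues_blocks (f := f \o enum_val)
  (a := fun=> -1) (b := 1)) => [|i j]; last first.
  rewrite !mxE edgeE (inj_eq enum_val_inj) /=.
  by case: eqP => [->|_]; rewrite ?eqxx /= ?addNr // mulr0n add0r.
rewrite rmorph_sum; apply: eq_bigr => c _.
rewrite card_enum_block rmorphD /= ratr_norm rmorphB /= rmorph1 ratr_nat.
by rewrite normrN1 [-1 + _]addrC.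
Qed.

(** On a block of size s the matrix is s I - J: eigenvalue 0 once and s with multiplicity s - 1. *)
Lemma clique_laplacian_energy (d := block_degree f) :
  laplacian_energy X =
  ratr (\sum_c (`|d| + ((block_size f c)%:R - 1) * `|(block_size f c)%:R - d|)).
Proof.
rewrite /laplacian_energy (sum_eigenvalues_blocks (f := f \o enum_val)
  (a := fun c => (block_size f c)%:R) (b := -1)) => [|i j]; last first.
  rewrite !mxE edgeE (inj_eq enum_val_inj) /=.
  case: eqP => [->|_]; rewrite ?eqxx /= ?subr0 ?mulr0n ?sub0r ?add0r.
    by rewrite -clique_degree -natr1 !mulr1n addrK.
  by rewrite mulNrn.
rewrite rmorph_sum; apply: eq_bigr => c _.
rewrite card_enum_block clique_average_degree -/d; move: d => d.
rewrite rmorphD rmorphM /=.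
rewrite !ratr_norm !rmorphB /= rmorph1 ratr_nat mulNrn addrN sub0r normrN.
by rewrite mulrBl mul1r mulr_natl.
Qed.

(** On a block of size s the matrix is (s - 2) I + J: eigenvalue 2s - 2 once and s - 2 with
    multiplicity s - 1. *)
Lemma clique_signless_laplacian_energy (d := block_degree f) :
  signless_laplacian_energy X =
  ratr (\sum_c (`|2 * (block_size f c)%:R - 2 - d|
         + ((block_size f c)%:R - 1) * `|(block_size f c)%:R - 2 - d|)).
Proof.
rewrite /signless_laplacian_energy (sum_eigenvalues_blocks (f := f \o enum_val)
  (a := fun c => (block_size f c)%:R - 2) (b := 1)) => [|i j]; last first.
  rewrite !mxE edgeE (inj_eq enum_val_inj) /=.
  case: eqP => [->|_]; rewrite ?eqxx /= ?addr0 ?mulr0n ?sub0r ?add0r //.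
  rewrite -clique_degree -natr1 !mulr1n; ring.
rewrite rmorph_sum; apply: eq_bigr => c _.
rewrite card_enum_block clique_average_degree -/d; move: d => d.
rewrite rmorphD rmorphM /=.
rewrite !ratr_norm !rmorphB rmorphM /= rmorph1 !ratr_nat.
rewrite mulrBl mul1r mulr_natl.
by congr (`| _ | + _); ring.
Qed.

End CliqueUnion.

Lemma complete_energies (N : nat) : (0 < N)%N ->
  [/\ energy (complete_graph N) = ratr (2 * (N%:R - 1)),
      laplacian_energy (complete_graph N) = ratr (2 * (N%:R - 1)) &
      signless_laplacian_energy (complete_graph N) = ratr (2 * (N%:R - 1))].
Proof.
move=> N0; pose f (u : complete_graph N) := tt.
have edgeE (u v : complete_graph N) : sedge u v = (u != v) && (f u == f v).
  by rewrite eqxx andbT.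
have sz c : block_size f c = N.
  rewrite /block_size -[RHS]card_ord; apply: eq_card => u.
  by rewrite inE; case: c.
have N1 : 1 <= N%:R :> rat by rewrite ler1n.
have sum1 (F : unit -> rat) : \sum_c F c = F tt.
  by rewrite (bigD1 tt) //= big_pred0 ?addr0 // => -[].
have d : block_degree f = N%:R - 1.
  by rewrite /block_degree !sum1 sz; field; lra.
rewrite (clique_energy edgeE) (clique_laplacian_energy edgeE).
rewrite (clique_signless_laplacian_energy edgeE) d.
rewrite !sum1 sz; split; congr ratr.
- rewrite ger0_norm; lra.
- rewrite ger0_norm; last lra.
  by rewrite (_ : _ - (_ - 1) = 1) ?normr1; ring.
- rewrite (_ : 2 * _ - 2 - _ = N%:R - 1); last ring.
  by rewrite (_ : _ - 2 - (_ - 1) = -1) ?normrN1 ?ger0_norm; lra || ring.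
Qed.

(** * Closed formulas for K_m + 2 K_1 and K_m + K_4 *)

Section CliqueUnionFormulas.
Variables (X : sgraph) (B : finType) (f : X -> B).
Hypothesis edgeE : forall u v : X, sedge u v = (u != v) && (f u == f v).

(** The hypothesis on [F] says that the nonempty blocks have sizes m, 1, 1. Quantifying over [F]
    lets it evaluate the order, the average degree and the three energies alike; each use owes the
    check that size 0 counts for 0. *)
Lemma energies_clique_two_points (m : nat) : (2 < m)%N ->
    (forall F : nat -> rat, F 0 = 0 ->
       \sum_c F (block_size f c) = F m + F 1 *+ 2) ->
  let m' := m%:R : rat in
  [/\ #|X| = (m + 2)%N, energy X = ratr (2 * (m' - 1)),
      laplacian_energy X = ratr (6 * m' * (m' - 1) / (m' + 2)) &
      signless_laplacian_energy X =
        ratr ((m' - 1) * (3 * m' + 4 + `|m' - 4|) / (m' + 2))].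
Proof.
move=> m2 sumF m'.
have m3 : 3 <= m' by rewrite /m' ler_nat.
have cX : #|X| = (m + 2)%N.
  apply/eqP; rewrite -(eqr_nat rat) (card_block_size f) natr_sum.
  by rewrite (sumF (fun s => s%:R)) // natrD.
have d : block_degree f = m' * (m' - 1) / (m' + 2).
  rewrite /block_degree (sumF (fun s => s%:R * (s%:R - 1))) ?mul0r //.
  by rewrite (sumF (fun s => s%:R)) // subrr mulr0 mul0rn addr0.
have i0 : 0 <= (m' + 2)^-1 by rewrite invr_ge0; lra.
have dn x : `|x / (m' + 2)| = `|x| / (m' + 2).
  by rewrite normrM (ger0_norm i0).
split=> //.
- rewrite (clique_energy edgeE) (sumF (fun s => `|s%:R - 1| + (s%:R - 1))).
    by congr ratr; rewrite subrr mul0rn addr0 -/m' ger0_norm; lra.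
  by rewrite sub0r normrN1 addrN.
- rewrite (clique_laplacian_energy edgeE) d.
  rewrite (sumF (fun s => `|_| + (s%:R - 1) * `|s%:R - _|)); last first.
    by rewrite !sub0r normrN mulN1r addrN.
  congr ratr; rewrite -/m' subrr mul0r addr0.
  rewrite (_ : m' - _ / _ = 3 * m' / (m' + 2)); last by field; lra.
  rewrite !ger0_norm; first (by field; lra);
    rewrite divr_ge0 ?mulr_ge0 //; lra.
- rewrite (clique_signless_laplacian_energy edgeE) d.
  rewrite (sumF (fun s => `|2 * s%:R - _ - _| + (s%:R - 1) * `|s%:R - _ - _|)).
    congr ratr; rewrite -/m' subrr mul0r addr0 sub0r normrN.
    (* Of the shifted eigenvalues, only the one with numerator [m' - 4] has a sign that varies over
       m > 2, so its modulus stays in the formula. *)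
    rewrite (_ : 2 * m' - 2 - _ = (m' - 1) * (m' + 4) / (m' + 2)); last first.
      by field; lra.
    rewrite (_ : m' - 2 - _ = (m' - 4) / (m' + 2)); last by field; lra.
    rewrite !dn (ger0_norm (_ : 0 <= _ * (m' + 4))); last nra.
    rewrite (ger0_norm (_ : 0 <= m' * _)); last nra.
    by field; lra.
  by rewrite mulr0 !sub0r mulN1r addrN.
Qed.

(** The three moduli left in the formulas are those whose argument changes sign on m >= 4; the other
    shifted eigenvalues have constant sign there. *)
Lemma energies_clique_clique4 (m : nat) : (3 < m)%N ->
    (forall F : nat -> rat, \sum_c F (block_size f c) = F m + F 4) ->
  let m' := m%:R : rat in
  [/\ #|X| = (m + 4)%N, energy X = ratr (2 * m' + 4),
      laplacian_energy X =
        ratr ((7 * m' ^+ 2 - 19 * m' + 36 + 3 * `|m' ^+ 2 - 5 * m' - 4|)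
                / (m' + 4)) &
      signless_laplacian_energy X =
        ratr ((4 * m' ^+ 2 - 2 * m' - 8 + (m' - 1) * `|3 * m' - 20|
                + `|m' ^+ 2 - 7 * m' - 12|) / (m' + 4))].
Proof.
move=> m3 sumF m'.
have m4 : 4 <= m' by rewrite /m' ler_nat.
have cX : #|X| = (m + 4)%N.
  apply/eqP; rewrite -(eqr_nat rat) (card_block_size f) natr_sum.
  by rewrite (sumF (fun s => s%:R)) // natrD.
have d : block_degree f = (m' * (m' - 1) + 12) / (m' + 4).
  rewrite /block_degree (sumF (fun s => s%:R * (s%:R - 1))).
  rewrite (sumF (fun s => s%:R)) -/m'; field; lra.
have i0 : 0 <= (m' + 4)^-1 by rewrite invr_ge0; lra.
have dn x : `|x / (m' + 4)| = `|x| / (m' + 4).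
  by rewrite normrM (ger0_norm i0).
split=> //.
- rewrite (clique_energy edgeE) (sumF (fun s => `|s%:R - 1| + (s%:R - 1))).
  by congr ratr; rewrite -/m' !ger0_norm; lra.
- rewrite (clique_laplacian_energy edgeE) d.
  rewrite (sumF (fun s => `|_| + (s%:R - 1) * `|s%:R - _|)) -/m'.
  congr ratr.
  rewrite (_ : m' - _ / _ = (5 * m' - 12) / (m' + 4)); last by field; lra.
  rewrite (_ : 4 - _ / _ = - ((m' ^+ 2 - 5 * m' - 4) / (m' + 4))); last first.
    by field; lra.
  rewrite normrN !dn (ger0_norm (_ : 0 <= _ + 12)); last nra.
  rewrite (ger0_norm (_ : 0 <= _ - 12)); last lra.
  by field; lra.
- rewrite (clique_signless_laplacian_energy edgeE) d.
  rewrite (sumF (fun s => `|2 * s%:R - _ - _| + (s%:R - 1) * `|s%:R - _ - _|)).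
  rewrite -/m'; congr ratr.
  rewrite (_ : 2 * m' - 2 - _ = (m' ^+ 2 + 7 * m' - 20) / (m' + 4)); last first.
    by field; lra.
  rewrite (_ : m' - 2 - _ = (3 * m' - 20) / (m' + 4)); last by field; lra.
  rewrite (_ : 2 * 4 - 2 - _ = - ((m' ^+ 2 - 7 * m' - 12) / (m' + 4)));
    last by field; lra.
  rewrite (_ : 4 - 2 - _ = - ((m' ^+ 2 - 3 * m' + 4) / (m' + 4))); last first.
    by field; lra.
  rewrite !normrN !dn (ger0_norm (_ : 0 <= _ - 20)); last nra.
  rewrite (ger0_norm (_ : 0 <= _ + 4)); last nra.
  by field; lra.
Qed.
End CliqueUnionFormulas.

End CliqueSpectra.

(** * Groups with an abelian subgroup of index two *)

Section AbelianIndexTwo.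
Local Open Scope group_scope.
Variables (gT : finGroupType) (G N : {group gT}).
Hypotheses (sNG : N \subset G) (cNN : abelian N) (iGN : #|G : N| = 2).
Hypothesis ncGG : ~~ abelian G.

(** A subgroup of prime index is maximal, and the join of [N] and [H] is strictly larger than
    [N]. *)
Lemma index2_mul (H : {group gT}) :
  H \subset G -> ~~ (H \subset N) -> N * H = G.
Proof.
move=> sHG nsHN; have /andP[_ nNG] := index2_normal sNG iGN.
have [_ maxN] : N \subset G /\ forall H : {group gT},
    N \subset H -> H \subset G -> H :=: N \/ H :=: G.
  by apply/maximal_eqP; rewrite /maximal_eq p_index_maximal ?orbT ?iGN.
rewrite -norm_joinEr ?(subset_trans sHG) //.
have [||eqN|//] := maxN (N <*> H)%G; rewrite ?joing_subl ?join_subG ?sNG //.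
by case/negP: nsHN; rewrite -eqN joing_subr.
Qed.

(** Otherwise [G] would be the product of [N] and its centre, two commuting abelian groups. *)
Lemma sub_center_index2 : 'Z(G) \subset N.
Proof.
apply: contraR ncGG => nsZN.
rewrite -(index2_mul (center_sub G) nsZN) abelianM cNN center_abelian /=.
by rewrite subIset // centS ?orbT.
Qed.

(** The centralizer contains the abelian group [N]; if it were larger it would be all of [G], and
    [x] would be central. *)
Lemma cent1_index2_in x : x \in N :\: 'Z(G) -> 'C_G[x] = N.
Proof.
case/setDP=> Nx nZx; apply/eqP; rewrite eqEsubset subsetI sNG /=.
rewrite sub_cent1 (subsetP cNN) // andbT; apply: contraR nZx => nsCN.
have defG := index2_mul (subsetIl G _) nsCN.
have Gx := subsetP sNG x Nx; rewrite inE Gx -sub_cent1 -defG mul_subG //.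
  by rewrite sub_cent1 (subsetP cNN).
exact: subsetIr.
Qed.

(** Since [G] is [N] times [<[g]>], an element of [N] that commutes with [g] commutes with both
    factors. *)
Lemma setI_cent1_index2_out g : g \in G :\: N -> N :&: 'C_G[g] = 'Z(G).
Proof.
case/setDP=> Gg nNg; apply/eqP; rewrite eqEsubset; apply/andP; split.
  apply/subsetP=> a /setIP[Na /setIP[Ga cga]]; rewrite inE Ga.
  rewrite -(index2_mul (_ : <[g]> \subset G)) ?cycle_subG // centM inE.
  by rewrite (subsetP cNN) // cent_cycle.
rewrite subsetI sub_center_index2 subsetI center_sub.
by rewrite -cent_set1 subIset // centS ?sub1set ?orbT.
Qed.

Lemma card_class_in x : x \in N :\: 'Z(G) -> #|x ^: G| = 2.
Proof. by move=> Nx; rewrite -index_cent1 cent1_index2_in. Qed.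

(** Here [G] is [N] times the centralizer C of [g], and N meets C in Z, so |N| |C| = |G| |Z|;
    dividing by |C| gives the claim. *)
Lemma card_class_out g : g \in G :\: N -> (#|g ^: G| * #|'Z(G)|)%N = #|N|.
Proof.
move=> NGg; have /setDP[Gg nNg] := NGg.
have defG : N * 'C_G[g] = G.
  apply: index2_mul (subsetIl _ _) _; apply: contra nNg => /subsetP->//.
  by rewrite inE Gg cent1id.
have := mul_cardG N 'C_G[g]; rewrite defG /= setI_cent1_index2_out //.
rewrite -(Lagrange (subsetIl G 'C[g])) index_cent1 -mulnA mulnC => /eqP.
by rewrite eqn_pmul2l ?cardG_gt0 // => /eqP.
Qed.

Lemma partition_class (D : {set gT}) :
  G \subset 'N(D) -> partition [set x ^: G | x in D] D.
Proof.
move=> nDG; have := @orbit_partition _ _ _ 'J G D.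
rewrite (eq_imset (g := fun x => x ^: G)); last exact: orbitJ.
by apply; rewrite astabsJ.
Qed.

Lemma vertex_ccc (C : CCC G) :
  {x | x \in G :\: 'Z(G) & val C = x ^: G :> {set gT}}.
Proof. by case: C => C /= /imsetP/sig2_eqW. Qed.

Lemma index2_norm : G \subset 'N(N).
Proof. by case/andP: (index2_normal sNG iGN). Qed.

Lemma class_sub_index2 x : (x ^: G \subset N) = (x \in N).
Proof. by rewrite class_sub_norm ?index2_norm. Qed.

Lemma card_ccc_in :
  (#|[set C : CCC G | val C \subset N]| * 2 = #|N| - #|'Z(G)|)%N.
Proof.
rewrite -cardsDS ?sub_center_index2 //.
have nND : G \subset 'N(N :\: 'Z(G)).
  by rewrite normsD ?index2_norm ?gFnorm.
rewrite (card_uniform_partition (n := 2) _ (partition_class nND)); last first.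
  by move=> _ /imsetP[x Nx ->]; exact: card_class_in.
rewrite -(card_imset _ val_inj); congr (#|pred_of_set _| * 2)%N.
apply/setP=> D; apply/imsetP/imsetP=> [[C] | [x NZx ->]].
  case: (vertex_ccc C) => x /setDP[Gx nZx] defC.
  rewrite inE defC class_sub_index2 => Nx ->.
  by exists x; rewrite // inE nZx.
have /setDP[Nx nZx] := NZx.
have Vx : x ^: G \in noncentral_classes G.
  by apply: imset_f; rewrite inE nZx (subsetP sNG).
by exists (exist (fun C => C \in noncentral_classes G) _ Vx);
  rewrite // inE class_sub_index2.
Qed.

(** Index 2 gives [G :\: N] exactly |N| elements, all noncentral, and they fall into classes of size
    |N| / |Z|. *)
Lemma card_ccc_out :
  #|[set C : CCC G | ~~ (val C \subset N)]| = #|'Z(G)|.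
Proof.
have nND : G \subset 'N(G :\: N) by rewrite normsD ?index2_norm ?normG.
have cGN : #|G :\: N| = #|N|.
  by rewrite cardsDS // -(Lagrange sNG) iGN; lia.
have Z0 := cardG_gt0 'Z(G).
have := @card_uniform_partition _ (#|N| %/ #|'Z(G)|) _ _ _
  (partition_class nND).
rewrite cGN => cN; have {cN}/cN cN : {in [set x ^: G | x in G :\: N],
    forall A : {set gT}, #|A| = (#|N| %/ #|'Z(G)|)%N}.
  by move=> _ /imsetP[x Nx ->]; rewrite -(card_class_out Nx) mulnK.
have dZN : #|'Z(G)| %| #|N| := cardSg sub_center_index2.
transitivity #|[set x ^: G | x in G :\: N]|.
  rewrite -(card_imset _ val_inj); congr #|pred_of_set _|.
  apply/setP=> D; apply/imsetP/imsetP=> [[C] | [x NGx ->]].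
    case: (vertex_ccc C) => x /setDP[Gx nZx] defC.
    rewrite inE defC class_sub_index2 => Nx ->.
    by exists x; rewrite // inE Nx.
  have /setDP[Gx nNx] := NGx.
  have Vx : x ^: G \in noncentral_classes G.
    by apply: imset_f; rewrite inE Gx (contra (subsetP sub_center_index2 x)).
  by exists (exist (fun C => C \in noncentral_classes G) _ Vx);
    rewrite // inE class_sub_index2.
apply/eqP; rewrite -(@eqn_pmul2r (#|N| %/ #|'Z(G)|)) -?cN ?divn_gt0 //.
  by rewrite mulnC divnK.
by rewrite dvdn_leq // cardG_gt0.
Qed.

Lemma ccc_edge_in (C D : CCC G) :
  val C \subset N -> val D \subset N -> sedge C D = (C != D).
Proof.
move=> sCN sDN; rewrite -[LHS]/(ccc_edge C D) /ccc_edge.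
case: (C =P D) => //= _.
case: (vertex_ccc C) (vertex_ccc D) => x _ defC [y _ defD].
have Cx : x \in val C by rewrite defC class_refl.
have Dy : y \in val D by rewrite defD class_refl.
apply/exists_inP; exists x => //; apply/exists_inP; exists y => //.
by apply/eqP/(centsP cNN); [exact: subsetP Cx | exact: subsetP Dy].
Qed.

Lemma ccc_mem (C : CCC G) x :
  x \in val C -> x \in G :\: 'Z(G) /\ val C = x ^: G.
Proof.
case: (vertex_ccc C) => y Gy -> /imsetP[a Ga ->].
rewrite classGidl // memJ_norm // (subsetP _ _ Ga) // normsD ?gFnorm ?normG //.
Qed.

(** A noncentral element of [N] has centralizer [N], so it commutes with nothing outside. *)
Lemma ccc_edge_in_out (C D : CCC G) :
  val C \subset N -> ~~ (val D \subset N) -> sedge C D = false.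
Proof.
move=> sCN nsDN; apply/negP=> /andP[_ /exists_inP[x Cx /exists_inP[y Dy]]].
have [Gx defC] := ccc_mem Cx; have [Gy defD] := ccc_mem Dy.
rewrite defC class_sub_index2 in sCN; rewrite defD class_sub_index2 in nsDN.
move=> /eqP xy; case/negP: nsDN; rewrite -(@cent1_index2_in x).
  by case/setDP: Gy => Gy _; rewrite inE Gy; apply/cent1P.
by case/setDP: Gx => _ Zx; rewrite inE Zx.
Qed.

(** If x and y lie outside [N] and commute, then y x^-1 lies in [N] by index 2 and centralizes x,
    hence is central. Adjacency outside [N] thus reduces to the action of the centre on classes. *)
Lemma ccc_commute_out (C D : CCC G) :
    ~~ (val C \subset N) -> ~~ (val D \subset N) ->
  [exists x in val C, [exists y in val D, x * y == y * x]] ->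
  exists2 g, g \in G :\: N & exists2 z, z \in 'Z(G) &
    val C = g ^: G /\ val D = (z * g) ^: G.
Proof.
move=> nsCN nsDN /exists_inP[x Cx /exists_inP[y Dy /eqP xy]].
have [/setDP[Gx _] defC] := ccc_mem Cx.
have [/setDP[Gy _] defD] := ccc_mem Dy.
rewrite defC class_sub_index2 in nsCN; rewrite defD class_sub_index2 in nsDN.
have GNx : x \in G :\: N by rewrite inE nsCN.
exists x => //; exists (y * x^-1); last by rewrite mulgKV.
rewrite -(setI_cent1_index2_out GNx) inE; apply/andP; split.
  by rewrite -mem_rcoset (rcoset_index2 sNG iGN GNx) inE nsDN.
rewrite inE groupM ?groupV //=; apply/cent1P.
by rewrite /commute mulgKV mulgA xy mulgK.
Qed.

(** The hypothesis makes every outer class stable under the centre, so commuting outer classes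
    coincide. *)
Lemma ccc_edge_out_split (C D : CCC G) :
    (forall g z, g \in G :\: N -> z \in 'Z(G) -> z * g \in g ^: G) ->
    ~~ (val C \subset N) -> ~~ (val D \subset N) -> sedge C D = false.
Proof.
move=> ZgG nsCN nsDN; apply/negP=> /andP[nCD].
case/(ccc_commute_out nsCN nsDN) => g GNg [z Zz [defC defD]].
case/eqP: nCD; apply: val_inj; rewrite defD defC.
exact/esym/class_eqP/ZgG.
Qed.

(** The hypothesis makes the centre transitive on outer classes, and [z * g] commutes with [g]. *)
Lemma ccc_edge_out_clique (C D : CCC G) :
    (forall g h, g \in G :\: N -> h \in G :\: N ->
       exists2 z, z \in 'Z(G) & z * g \in h ^: G) ->
    ~~ (val C \subset N) -> ~~ (val D \subset N) -> sedge C D = (C != D).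
Proof.
move=> ZgG nsCN nsDN; rewrite -[LHS]/(ccc_edge C D) /ccc_edge.
case: (C =P D) => //= _.
case: (vertex_ccc C) => g /setDP[Gg _] defC.
case: (vertex_ccc D) => h /setDP[Gh _] defD.
rewrite defC class_sub_index2 in nsCN; rewrite defD class_sub_index2 in nsDN.
have [||z Zz zgD] := ZgG g h; rewrite ?inE ?nsCN ?nsDN //.
apply/exists_inP; exists g; first by rewrite defC class_refl.
apply/exists_inP; exists (z * g); first by rewrite defD.
case/centerP: Zz => _ /(_ g Gg) cgz.
by apply/eqP; rewrite mulgA -cgz.
Qed.

(* Some C indexes the possible singleton block {C}: the blocks Some C with C
   inside N are empty, hence the hypothesis F 0 = 0. *)
Lemma ccc_split :
    (forall g z, g \in G :\: N -> z \in 'Z(G) -> z * g \in g ^: G) ->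
  exists2 f : CCC G -> option (CCC G),
    forall C D, sedge C D = (C != D) && (f C == f D) &
    forall F : nat -> rat, F 0%N = 0%R ->
      (\sum_c F (block_size f c) = F ((#|N| - #|'Z(G)|) %/ 2)%N
                                  + F 1%N *+ #|'Z(G)|)%R.
Proof.
move=> ZgG; exists (fun C : CCC G => if val C \subset N then None else Some C).
  move=> C D; case sCN: (val C \subset N); case sDN: (val D \subset N).
  - by rewrite ccc_edge_in // andbT.
  - by rewrite ccc_edge_in_out ?sDN // andbF.
  - by rewrite sedge_sym ccc_edge_in_out ?sCN // andbF.
  - rewrite ccc_edge_out_split ?sCN ?sDN // (inj_eq Some_inj).
    by case: eqP.
set f := fun C : CCC G => _; move=> F F0.
rewrite (bigD1 None) //= -card_ccc_in mulnK //; congr (F _ + _)%R.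
  by apply: eq_card => C; rewrite !inE /f; case: ifP.
rewrite -card_ccc_out -sumr_const.
rewrite (reindex_omap Some id) /=; last by case.
rewrite [RHS]big_mkcond [LHS]big_mkcond; apply: eq_bigr => C _ /=.
rewrite eqxx inE; have [sCN|nsCN] := boolP (val C \subset N).
  rewrite -[RHS]F0; congr F; apply/eqP; rewrite cards_eq0; apply/eqP/setP => D.
  rewrite !inE /f; case: ifP => // nD.
  by apply/eqP=> -[DC]; rewrite DC sCN in nD.
rewrite /block_size (_ : [set _ | _] = [set C]) ?cards1 //.
apply/setP=> D; rewrite !inE /f; case: ifP => [sD|_] //.
by apply/esym/eqP=> DC; rewrite -DC sD in nsCN.
Qed.

Lemma ccc_clique :
    (forall g h, g \in G :\: N -> h \in G :\: N ->
       exists2 z, z \in 'Z(G) & z * g \in h ^: G) ->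
  exists2 f : CCC G -> bool,
    forall C D, sedge C D = (C != D) && (f C == f D) &
    forall F : nat -> rat,
      (\sum_c F (block_size f c) = F ((#|N| - #|'Z(G)|) %/ 2)%N
                                  + F #|'Z(G)|)%R.
Proof.
move=> ZgG; exists (fun C : CCC G => val C \subset N).
  move=> C D; case sCN: (val C \subset N); case sDN: (val D \subset N).
  - by rewrite ccc_edge_in // andbT.
  - by rewrite ccc_edge_in_out ?sDN // andbF.
  - by rewrite sedge_sym ccc_edge_in_out ?sCN // andbF.
  - by rewrite ccc_edge_out_clique ?sCN ?sDN // andbT.
move=> F; rewrite big_bool -card_ccc_in mulnK // -card_ccc_out.
congr (F _ + F _)%R; apply: eq_card => C; rewrite !inE.
  by case: (_ \subset _).
by case: (_ \subset _).
Qed.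

End AbelianIndexTwo.

(** * Semidihedral groups *)

Section Semidihedral.
Local Open Scope group_scope.

(* The affine maps i |-> i + 1 and i |-> (2n - 1) i of Z/4n satisfy the
   relations, so the presented group is not smaller than expected. *)
Lemma semidihedral_affine (n : nat) : (2 <= n)%N ->
  exists (gT : finGroupType) (H : {group gT}), (8 * n <= #|H|)%N /\
    H \homg Grp (x : y : x ^+ (4 * n)%N, y ^+ 2,
                  y * x * y = x ^+ (2 * n - 1)%N).
Proof.
move=> n2; pose q := (4 * n)%N; pose e := (2 * n - 1)%N.
have q1 : (1 < q)%N by rewrite /q; lia.
have natr_eq0 k : (k%:R == 0 :> 'Z_q)%R = (q %| k)%N.
  by rewrite -val_eqE /= val_Zp_nat.
(* Since (2n - 1)^2 = (n - 1) 4n + 1, multiplication by 2n - 1 is an involution of Z/4n. *)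
have ee : (e%:R * e%:R = 1 :> 'Z_q)%R.
  rewrite -natrM (_ : (e * e)%N = (n.-1 * q).+1)%N; last by rewrite /e /q; nia.
  by rewrite -natr1 natrM (pchar_Zp q1) mulr0 add0r.
pose a : {perm 'Z_q} := perm (@addIr _ (1 : 'Z_q)%R).
have inj_b : injective (fun i : 'Z_q => e%:R * i)%R.
  by apply: (can_inj (g := fun i => e%:R * i)%R) => i; rewrite mulrA ee mul1r.
pose b : {perm 'Z_q} := perm inj_b.
have aE k i : (a ^+ k) i = (i + k%:R)%R.
  elim: k => [|k IHk]; first by rewrite perm1 addr0.
  by rewrite expgSr permM IHk permE -natr1 addrA.
have bE i : b i = (e%:R * i)%R by rewrite permE.
exists {perm 'Z_q}, (<[a]> <*> <[b]>)%G; split; last first.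
  apply/existsP; exists (a, b); rewrite /= !xpair_eqE eqxx /=.
  apply/and3P; split; apply/eqP/permP=> i.
  - by rewrite aE perm1 pchar_Zp ?addr0.
  - by rewrite expgS expg1 permM !bE mulrA ee mul1r perm1.
  - by rewrite !permM !bE -[a]expg1 !aE mulrDr mulrA ee mul1r mulr1.
have oa : (q <= #[a])%N.
  rewrite dvdn_leq ?order_gt0 // -natr_eq0 -[(_%:R)%R]add0r -aE.
  by rewrite expg_order perm1.
(* The map [b] fixes 0, and a translation fixing 0 is the identity, whereas [b] sends 1 to 2n -
   1. *)
have nab : b \notin <[a]>.
  apply/cycleP=> -[k bk]; have: b 0%R = 0%R by rewrite bE mulr0.
  rewrite bk aE add0r => k0; have: b 1%R = 1%R by rewrite bk aE k0 addr0.
  move=> /(congr1 val); rewrite bE mulr1 /= val_Zp_nat // modn_small.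
    by rewrite Zp_cast // modn_small // /e; lia.
  by rewrite /e /q; lia.
have sab : <[a]> \subset <[a]> <*> <[b]> by exact: joing_subl.
have iab : (1 < #|<[a]> <*> <[b]> : <[a]>|)%N.
  rewrite indexg_gt1; apply: contra nab => /subsetP-> //.
  by rewrite mem_gen // inE cycle_id orbT.
rewrite -(Lagrange sab) -orderE (leq_trans _ (leq_mul oa iab)) // /q; lia.
Qed.

(** The affine model is an image of [G], so |G| >= 8n, while the relations give #[x] <= 4n, #[y] <=
    2 and |G| <= #[x] #[y]; all these are equalities. An element outside [<[x]>] has the form x^j y,
    so it acts on [<[x]>] as y does. *)
Lemma semidihedral_cycle (n : nat) (gT : finGroupType) (G : {group gT}) :
    (2 <= n)%N ->
    G \isog Grp (x : y : x ^+ (4 * n)%N, y ^+ 2,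
                  y * x * y = x ^+ (2 * n - 1)%N) ->
  exists x : gT, [/\ <[x]> \subset G, #[x] = (4 * n)%N, #|G : <[x]>| = 2 &
    forall g k, g \in G :\: <[x]> -> (x ^+ k) ^ g = x ^+ ((2 * n - 1) * k)].
Proof.
move=> n2 isoG; have [hT [H [oH]]] := semidihedral_affine n2.
rewrite -isoG => /card_homg/dvdn_leq - /(_ (cardG_gt0 _)) leHG.
have /existsP[[x y] /= /eqP[defG xq y2 xy]] := isoGrp_hom isoG.
have Gx : <[x]> \subset G by rewrite -defG joing_subl.
have xJ k : (x ^+ k) ^ y = x ^+ ((2 * n - 1) * k).
  have yV : y^-1 = y by apply/eqP; rewrite eq_invg_mul -[_ * _]/(y ^+ 2) y2.
  by rewrite conjXg expgM -xy conjgE yV mulgA.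
have nxy : <[y]> \subset 'N(<[x]>).
  by rewrite norms_cycle -{1}[x]expg1 xJ mem_cycle.
have oG : (8 * n <= #[x] * #[y])%N.
  apply: leq_trans oH (leq_trans leHG _).
  by rewrite -{1}defG norm_joinEr // mul_cardG leq_pmulr ?cardG_gt0.
have ox : (#[x] <= 4 * n)%N by rewrite dvdn_leq ?order_dvdn ?xq //; lia.
have oy : (#[y] <= 2)%N by rewrite dvdn_leq // order_dvdn y2.
have oxE : #[x] = (4 * n)%N by nia.
have ixG : #|G : <[x]>| = 2.
  have := Lagrange Gx; rewrite -orderE oxE => oGE.
  have : (#|G| <= #[x] * #[y])%N.
    by rewrite -{1}defG norm_joinEr // mul_cardG leq_pmulr ?cardG_gt0.
  rewrite oxE => leG; apply/eqP; rewrite -(@eqn_pmul2l (4 * n)) ?oGE; last lia.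
  rewrite eqn_leq (leq_trans leG) ?leq_mul //.
  by apply: leq_trans (leq_trans oH leHG); lia.
exists x; split=> // g k /setDP[Gg nxg].
have defGy : <[x]> :* y = G :\: <[x]>.
  apply: rcoset_index2; rewrite // inE -defG.
  rewrite (subsetP (joing_subr _ _)) ?cycle_id //.
  rewrite andbT; apply/negP=> xy'; move: ixG.
  by rewrite -defG (joing_idPl _) ?cycle_subG // indexgg.
have: g \in <[x]> :* y by rewrite defGy inE nxg.
case/rcosetP=> _ /cycleP[j ->] ->.
by rewrite conjgM [_ ^ (x ^+ j)]conjgE (commuteX2 k j (commute_refl x)) mulKg.
Qed.
End Semidihedral.

(** * The centre and the classes outside the cyclic subgroup *)

Section SemidihedralClasses.
Local Open Scope group_scope.
Variables (n : nat) (gT : finGroupType) (G : {group gT}) (x : gT).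
Hypotheses (n2 : (2 <= n)%N) (sxG : <[x]> \subset G) (ox : #[x] = (4 * n)%N).
Hypothesis ixG : #|G : <[x]>| = 2.
Hypothesis xJ : forall g k,
  g \in G :\: <[x]> -> (x ^+ k) ^ g = x ^+ ((2 * n - 1) * k).

Lemma cycle_outside : exists g, g \in G :\: <[x]>.
Proof.
by apply/set0Pn; rewrite setD_eq0 -indexg_eq1 ixG.
Qed.

Lemma semidihedral_nonabelian : ~~ abelian G.
Proof.
have [g GNg] := cycle_outside; have /setDP[Gg _] := GNg.
apply/negP=> /centsP cGG; have Gx : x \in G by rewrite -cycle_subG.
have := xJ 1 GNg; rewrite muln1 expg1 conjgE (cGG x Gx g Gg) mulKg => /eqP.
by rewrite -{1}[x]expg1 eq_expg_mod_order ox !modn_small; lia.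
Qed.

(** All outer elements act on [<[x]>] as the power 2n - 1, so centrality means that x^i is fixed by
    this power map. *)
Lemma mem_center_semidihedral i :
  (x ^+ i \in 'Z(G)) = (4 * n %| (2 * n - 2) * i)%N.
Proof.
have xX_eq : (x ^+ i == x ^+ ((2 * n - 1) * i)) = (4 * n %| (2 * n - 2) * i)%N.
  rewrite eq_sym eq_expg_mod_order ox eqn_mod_dvd; last by nia.
  by congr (_ %| _)%N; nia.
rewrite -xX_eq; apply/centerP/eqP => [[_ cxG]|xX].
  have [g GNg] := cycle_outside; have /setDP[Gg _] := GNg.
  by rewrite -(xJ i GNg) conjgE (cxG g Gg) mulKg.
split=> [|g Gg]; first by rewrite groupX // -cycle_subG.
have [xg|nxg] := boolP (g \in <[x]>).
  by apply: (centsP (cycle_abelian x)); rewrite ?mem_cycle.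
by apply/commgP/conjg_fixP; rewrite xJ ?inE ?nxg.
Qed.

Lemma center_semidihedral m :
    (forall i, (4 * n %| (2 * n - 2) * i) = (m %| i))%N ->
  'Z(G) = <[x ^+ m]>.
Proof.
move=> mP; apply/eqP; rewrite eqEsubset; apply/andP; split; last first.
  by rewrite cycle_subG mem_center_semidihedral mP.
apply/subsetP=> z Zz.
have sZx := sub_center_index2 sxG (cycle_abelian x) ixG semidihedral_nonabelian.
have /cycleP[i zE] := subsetP sZx z Zz; move: Zz.
rewrite {}zE mem_center_semidihedral mP => /dvdnP[j ->].
by rewrite mulnC expgM mem_cycle.
Qed.

Lemma conjg_outside g k : g \in G :\: <[x]> ->
  g ^ (x ^+ k) = x ^+ ((2 * n - 2) * k) * g.
Proof.
move=> GNg; have GNgV : g^-1 \in G :\: <[x]> by rewrite inE !groupV -in_setD.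
have: (x ^+ k) ^ g^-1 = x ^+ k * x ^+ ((2 * n - 2) * k).
  by rewrite xJ // -expgD; congr (x ^+ _); nia.
rewrite conjgE invgK => xg; rewrite conjgE -[g * _](mulgKV g) mulgA.
by rewrite -[X in _ * X * g]mulgA xg mulKg.
Qed.

(** Cancelling 2 leaves 2n dividing (n - 1) i, and n - 1 is coprime to n and, as n is even, odd. *)
Lemma center_even : ~~ odd n -> 'Z(G) = <[x ^+ (2 * n)]>.
Proof.
move=> evn; apply: center_semidihedral => i.
rewrite (_ : 4 * n = 2 * (2 * n))%N; last by lia.
rewrite (_ : (2 * n - 2) * i = 2 * (n.-1 * i))%N; last by nia.
rewrite dvdn_pmul2l // Gauss_dvdr // coprimeMl coprime2n.
rewrite -{2}(prednK (ltnW n2)) coprimeSn // andbT.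
by rewrite -[odd _]negbK -oddS (prednK (ltnW n2)).
Qed.

(** With n = 2k + 1 the condition reads 4n divides 4 k i, and k is coprime to 2k + 1. *)
Lemma center_odd : odd n -> 'Z(G) = <[x ^+ n]>.
Proof.
move=> oddn; apply: center_semidihedral => i.
have [k nE] : exists k, n = k.*2.+1.
  by exists n./2; rewrite -[LHS]odd_double_half oddn.
rewrite (_ : (2 * n - 2) * i = 4 * (k * i))%N; last by rewrite nE; nia.
rewrite dvdn_pmul2l // Gauss_dvdr // nE -addnn -addnS coprime_sym.
by rewrite /coprime gcdnDl; exact: coprimenS.
Qed.

Lemma card_center_even : ~~ odd n -> #|'Z(G)| = 2.
Proof.
move=> /center_even->.
rewrite -orderE orderXdiv ox ?dvdn_pmul2r //; last by lia.
by rewrite (_ : 4 * n = 2 * (2 * n))%N ?mulnK //; lia.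
Qed.

Lemma card_center_odd : odd n -> #|'Z(G)| = 4.
Proof.
move=> /center_odd->; rewrite -orderE orderXdiv ox ?dvdn_mull // mulnK //; lia.
Qed.

Lemma center_mul_class_even g z : ~~ odd n ->
  g \in G :\: <[x]> -> z \in 'Z(G) -> z * g \in g ^: G.
Proof.
move=> evn GNg; rewrite center_even // => /cycleP[i ->].
have Gx : x \in G by rewrite -cycle_subG.
(* Conjugation by this element multiplies [g] by x^((2n - 2) n i). The exponent exceeds 2n i by 2n
   (n - 2) i, a multiple of 4n for n even. *)
apply/imsetP; exists (x ^+ (n * i)); first by rewrite groupX.
rewrite conjg_outside // -expgM; congr (_ * _); apply/eqP.
rewrite eq_sym eq_expg_mod_order ox eqn_mod_dvd; last by nia.
have [k nE] : exists k, n = k.*2.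
  by exists n./2; rewrite -[LHS]odd_double_half (negbTE evn).
apply/dvdnP; exists (k.-1 * i)%N; move: n2; rewrite nE.
by case: k {nE} => // k _; nia.
Qed.

(* The witnesses come from 1 = n * n - (2n - 2) * ((n + 1) / 2), n odd. *)
Lemma center_mul_class_odd g h : odd n ->
    g \in G :\: <[x]> -> h \in G :\: <[x]> ->
  exists2 z, z \in 'Z(G) & z * g \in h ^: G.
Proof.
move=> oddn GNg GNh.
have Gx : x \in G by rewrite -cycle_subG.
have /rcosetP[_ /cycleP[k ->] hE] : h \in <[x]> :* g.
  by rewrite (rcoset_index2 sxG ixG GNg).
exists ((x ^+ n) ^+ (n * k)); first by rewrite center_odd ?mem_cycle.
have [j nE] : exists j, n = j.*2.+1.
  by exists n./2; rewrite -[LHS]odd_double_half oddn.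
apply/imsetP; exists (x ^+ (j.+1 * k)); first by rewrite groupX.
rewrite conjg_outside // hE mulgA -expgM -expgD; congr (x ^+ _ * _).
by rewrite nE; nia.
Qed.

End SemidihedralClasses.

(** * Comparison with complete graphs *)

Section Comparisons.
Local Open Scope ring_scope.

(** [ratr] is an order embedding, so the comparisons in [algC] become comparisons in [rat]. *)
Lemma energetic_ratr (X : sgraph) (N e l q : rat) : (0 < #|X|)%N ->
    N = #|X|%:R -> energy X = ratr e -> laplacian_energy X = ratr l ->
    signless_laplacian_energy X = ratr q ->
  [/\ hyperenergetic X = (2 * (N - 1) < e),
      borderenergetic X = (2 * (N - 1) == e),
      L_hyperenergetic X = (2 * (N - 1) < l),
      L_borderenergetic X = (2 * (N - 1) == l) &
      Q_hyperenergetic X = (2 * (N - 1) < q) /\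
      Q_borderenergetic X = (2 * (N - 1) == q)].
Proof.
move=> /complete_energies[cE cL cQ] -> eE lE qE.
rewrite /hyperenergetic /borderenergetic /L_hyperenergetic /L_borderenergetic.
rewrite /Q_hyperenergetic /Q_borderenergetic cE cL cQ eE lE qE.
by rewrite !ltr_rat !(inj_eq (fmorph_inj _)).
Qed.

Lemma clique_two_points_energetic (X : sgraph) (B : finType)
    (f : X -> B) (m : nat) :
    (forall u v : X, sedge u v = (u != v) && (f u == f v)) -> (2 < m)%N ->
    (forall F : nat -> rat, F 0 = 0 ->
       \sum_c F (block_size f c) = F m + F 1 *+ 2) ->
  [/\ ~ hyperenergetic X, ~ borderenergetic X,
      m = 3 -> [/\ ~ L_hyperenergetic X, ~ L_borderenergetic X,
                 ~ Q_hyperenergetic X & ~ Q_borderenergetic X] &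
      (6 <= m)%N -> [/\ L_hyperenergetic X, ~ L_borderenergetic X,
                 Q_hyperenergetic X & ~ Q_borderenergetic X]].
Proof.
move=> edgeE m2 sumF.
have [cX eE lE qE] := energies_clique_two_points edgeE m2 sumF.
have X0 : (0 < #|X|)%N by rewrite cX addn_gt0 orbT.
have NE : m%:R + 2 = #|X|%:R :> rat by rewrite cX natrD.
have [-> -> -> -> [-> ->]] := energetic_ratr X0 NE eE lE qE.
have [x xm] : exists x : rat, m%:R = x by exists m%:R.
have x3 : 3 <= x by rewrite -xm ler_nat.
rewrite xm {cX eE lE qE NE}; split; [lra | lra | | ].
- move=> m3; have {x3}-> : x = 3 by rewrite -xm m3.
  have -> : `|3 - 4| = 1 :> rat by [].
  by split; apply/negP.
- rewrite -(ler_nat rat) xm => x6.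
  have L : 2 * (x + 2 - 1) < 6 * x * (x - 1) / (x + 2).
    by rewrite ltr_pdivlMr; nra.
  (* Cleared of denominators this is x^2 - 5x - 2 > 0, false at 5 and true from 6 on. *)
  have Q : 2 * (x + 2 - 1) < (x - 1) * (3 * x + 4 + `|x - 4|) / (x + 2).
    by rewrite ltr_pdivlMr ?ger0_norm; nra.
  by rewrite L Q !lt_eqF.
Qed.

Lemma clique_clique4_energetic (X : sgraph) (B : finType)
    (f : X -> B) (m : nat) :
    (forall u v : X, sedge u v = (u != v) && (f u == f v)) -> (3 < m)%N ->
    (forall F : nat -> rat, \sum_c F (block_size f c) = F m + F 4) ->
  [/\ ~ hyperenergetic X, ~ borderenergetic X,
      m = 4 -> [/\ ~ L_hyperenergetic X, ~ L_borderenergetic X,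
                 ~ Q_hyperenergetic X & ~ Q_borderenergetic X],
      m = 8 -> [/\ L_hyperenergetic X, ~ L_borderenergetic X,
                 ~ Q_hyperenergetic X & Q_borderenergetic X] &
      (10 <= m)%N -> [/\ L_hyperenergetic X, ~ L_borderenergetic X,
                 Q_hyperenergetic X & ~ Q_borderenergetic X]].
Proof.
move=> edgeE m3 sumF.
have [cX eE lE qE] := energies_clique_clique4 edgeE m3 sumF.
have X0 : (0 < #|X|)%N by rewrite cX addn_gt0 orbT.
have NE : m%:R + 4 = #|X|%:R :> rat by rewrite cX natrD.
have [-> -> -> -> [-> ->]] := energetic_ratr X0 NE eE lE qE.
have [x xm] : exists x : rat, m%:R = x by exists m%:R.
have x4 : 4 <= x by rewrite -xm ler_nat.
rewrite xm {cX eE lE qE NE}; split; [lra | lra | | | ].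
- move=> m4; have {x4}-> : x = 4 by rewrite -xm m4.
  by split; apply/negP.
- move=> m8; have {x4} x8 : x = 8 by rewrite -xm m8.
  have L : 2 * (x + 4 - 1) <
      (7 * x ^+ 2 - 19 * x + 36 + 3 * `|x ^+ 2 - 5 * x - 4|) / (x + 4).
    by rewrite ltr_pdivlMr ?ger0_norm; nra.
  (* At x = 8 the last modulus is that of -4, and both sides equal 22. *)
  have <- : 2 * (x + 4 - 1) =
      (4 * x ^+ 2 - 2 * x - 8 + (x - 1) * `|3 * x - 20|
         + `|x ^+ 2 - 7 * x - 12|) / (x + 4).
    rewrite (ger0_norm (_ : 0 <= _ - 20)); last by nra.
    rewrite ler0_norm; last by nra.
    by apply: (canRL (mulfK _)); rewrite x8; [lra | ring].
  by rewrite L ltxx eqxx lt_eqF.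
- rewrite -(ler_nat rat) xm => x10.
  have L : 2 * (x + 4 - 1) <
      (7 * x ^+ 2 - 19 * x + 36 + 3 * `|x ^+ 2 - 5 * x - 4|) / (x + 4).
    by rewrite ltr_pdivlMr ?ger0_norm; nra.
  (* For x >= 10 both moduli open positively, the numerator becomes 8x (x - 4), and the claim is
     3x^2 - 23x - 12 > 0. *)
  have Q : 2 * (x + 4 - 1) <
      (4 * x ^+ 2 - 2 * x - 8 + (x - 1) * `|3 * x - 20|
         + `|x ^+ 2 - 7 * x - 12|) / (x + 4).
    by rewrite ltr_pdivlMr ?ger0_norm; nra.
  by rewrite L Q !lt_eqF.
Qed.
End Comparisons.

Theorem theorem5p5 (n : nat) (gT : finGroupType) (G : {group gT})
    (hn : (2 <= n)%N)
    (hG : (G \isog Grp (x : y : x ^+ (4 * n)%N, y ^+ 2,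
                          y * x * y = x ^+ (2 * n - 1)%N))%g) :
  (n = 2 \/ n = 3 ->
     ~ hyperenergetic (CCC G) /\ ~ borderenergetic (CCC G) /\
     ~ L_hyperenergetic (CCC G) /\ ~ L_borderenergetic (CCC G) /\
     ~ Q_hyperenergetic (CCC G) /\ ~ Q_borderenergetic (CCC G)) /\
  (n = 5 ->
     L_hyperenergetic (CCC G) /\ Q_borderenergetic (CCC G) /\
     ~ hyperenergetic (CCC G) /\ ~ borderenergetic (CCC G) /\
     ~ L_borderenergetic (CCC G) /\ ~ Q_hyperenergetic (CCC G)) /\
  (n = 4 \/ (6 <= n)%N ->
     L_hyperenergetic (CCC G) /\ Q_hyperenergetic (CCC G) /\
     ~ hyperenergetic (CCC G) /\ ~ borderenergetic (CCC G) /\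
     ~ L_borderenergetic (CCC G) /\ ~ Q_borderenergetic (CCC G)).
Proof.
have [x [sxG ox ixG xJ]] := semidihedral_cycle hn hG.
have ncG := semidihedral_nonabelian hn sxG ox ixG xJ.
(* For n odd the large clique has m = 2n - 2 vertices, so n = 3, n = 5, n >= 7 become m = 4, m = 8,
   m >= 12. For n even m = 2n - 1, so n = 2 and n >= 4 become m = 3 and m >= 7. *)
have [oddn | evenn] := boolP (odd n).
  have [g h|f edgeE] := ccc_clique sxG (cycle_abelian x) ixG ncG.
    exact: (center_mul_class_odd hn sxG ox ixG xJ).
  rewrite -orderE ox (card_center_odd hn sxG ox ixG xJ oddn).
  rewrite (_ : ((4 * n - 4) %/ 2)%N = (2 * n - 2)%N); last by lia.
  have m3 : (3 < 2 * n - 2)%N.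
    by case: n hn oddn {hG ox xJ ncG} => [|[|[|k]]] //; lia.
  case/(clique_clique4_energetic edgeE m3) => nH nB m4 m8 m10.
  split=> [[n2|n3]|]; first by rewrite n2 in oddn.
    by have [] := m4 _; [lia | do !split].
  split=> [n5|[n4|n6]]; last 2 first.
  - by rewrite n4 in oddn.
  - by have [] := m10 _; [lia | do !split].
  by have [] := m8 _; [lia | do !split].
have [g z|f edgeE] := ccc_split sxG (cycle_abelian x) ixG ncG.
  exact: (center_mul_class_even hn sxG ox ixG xJ).
rewrite -orderE ox (card_center_even hn sxG ox ixG xJ evenn).
rewrite (_ : ((4 * n - 2) %/ 2)%N = (2 * n - 1)%N); last by lia.
have m2 : (2 < 2 * n - 1)%N by lia.
case/(clique_two_points_energetic edgeE m2) => nH nB m3 m6.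
split=> [[n2|n3]|]; last 2 first.
- by rewrite n3 in evenn.
- split=> [n5|n46]; first by rewrite n5 in evenn.
  by have [] := m6 _; [lia | do !split].
by have [] := m3 _; [lia | do !split].
Qed.
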